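(* Let $\mathbb{H}$ be a complex Hilbert space and let $A,B\in\mathbb{B}(\mathbb{H})$. Then $$\omega_e^2(A,B)\le\sqrt{\omega^2(A)\|A\|^2+\omega^2(B)\|B\|^2+2\,\omega(A)\,\omega(B)\,\omega(B^*A)}.$$
   Context: $\mathbb{B}(\mathbb{H})$ is the algebra of bounded linear operators on $\mathbb{H}$, $\|\cdot\|$ is the operator norm, and $\omega(T)=\sup_{\|x\|=1}|\langle Tx,x\rangle|$ is the numerical radius. The Euclidean operator radius of a pair is $\omega_e(A,B)=\sup_{\|x\|=1}\left(|\langle Ax,x\rangle|^2+|\langle Bx,x\rangle|^2\right)^{1/2}$. Powers such as $\omega^2(A)$ mean $(\omega(A))^2$, and $\omega_e^2(A,B)=(\omega_e(A,B))^2$. *)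

(* Defs.v *)
From HB Require Import structures.
From mathcomp Require Import all_boot all_order all_algebra.
From mathcomp Require Import complex.
From mathcomp Require Import boolp classical_sets reals topology normedtype.

Set Implicit Arguments.
Unset Strict Implicit.
Unset Printing Implicit Defensive.

Import Order.TTheory GRing.Theory Num.Theory.
Import numFieldNormedType.Exports.

Local Open Scope classical_set_scope.
Local Open Scope ring_scope.
Local Open Scope complex_scope.

(* The inner product is linear in its first argument and conjugate-linear in
   its second one, and it induces the norm for which the space is complete. *)
HB.mixin Record isHilbert (R : realType) H & CompleteNormedModule R[i] H := {
  inner : {dot H for (@Num.conj R[i])} ;
  inner_norm : forall x : H, inner x x = `|x| ^+ 2
}.

#[short(type="hilbertType")]
HB.structure Definition Hilbert (R : realType) :=
  {H of isHilbert R H & CompleteNormedModule R[i] H}.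

(* MathComp norms on complex spaces take values in R[i]; they are real numbers,
   so complex.Re `|_| is the same norm seen in R, where suprema live.  When
   H = 0 the unit sphere is empty and each supremum below is sup set0 = 0. *)
Section operators.
Context {R : realType} {H : hilbertType R}.
Implicit Types S T : H -> H.

Definition bounded_op T := exists M : R, forall x, `|T x| <= M%:C * `|x|.

Definition opnorm T : R :=
  sup [set complex.Re `|T x| | x in [set x : H | `|x| = 1]].

Definition numradius T : R :=
  sup [set complex.Re `|inner (T x) x| | x in [set x : H | `|x| = 1]].

Definition euclid_radius S T : R :=
  sup [set Num.sqrt (complex.Re `|inner (S x) x| ^+ 2
                     + complex.Re `|inner (T x) x| ^+ 2)
      | x in [set x : H | `|x| = 1]].

(* By the Riesz representation theorem such a z exists, and it is unique,
   whenever T is linear and bounded. *)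
Definition adjoint T : H -> H :=
  fun y => get [set z : H | forall x, inner (T x) y = inner x z].

End operators.

(* Main.v *)
Require Import Defs.
From mathcomp Require Import all_boot all_order all_algebra.
From mathcomp Require Import complex.
From mathcomp Require Import boolp classical_sets reals topology normedtype.
From mathcomp Require Import ring.
Import Order.TTheory GRing.Theory Num.Theory.
Import numFieldNormedType.Exports.
Local Open Scope ring_scope.

(** Fix a unit vector [x] and let [a = <Ax,x>], [b = <Bx,x>].  The sum
    [|a|^2 + |b|^2] is the single inner product [<w,x>] of [x] with
    [w = a^* Ax + b^* Bx], so by Cauchy-Schwarz its square is at most [|w|^2].
    Expanding [|w|^2] gives the two diagonal terms [|a|^2 |Ax|^2] and
    [|b|^2 |Bx|^2] and a cross term bounded by [2 |a| |b| |<Ax,Bx>|]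
    ([sqr_inner_pair_le]).  Since [<Ax,Bx>] and [<B^*Ax,x>] have the same
    modulus, every factor is bounded by a norm or a numerical radius, and
    the supremum over [x] gives the theorem.

    The operator [adjoint B] is chosen among the solutions [z] of
    [<Bx,y> = <x,z>], so its characteristic property rests on the Riesz
    representation theorem ([riesz]).  A scalar inequality that holds at every
    [v] can be tested at the best multiple of [v]; this optimization
    ([norm_le_of_quadratic]) yields Cauchy-Schwarz from [|x - v|^2 >= 0].
    Applied to a point [x] that nearly minimizes [|v|^2 - 2 Re (f v)], it shows
    that [<-,x>] nearly represents [f] ([approx_riesz]).  Two near representers
    are close to each other, so by completeness they converge, and the limit
    represents [f] exactly. *)

(** The hypothesis is quadratic on each complex line, so it is sharpest at one
    multiple of [v]: scaling by [(g v)^* / |v|^2] makes both [g v] and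
    [|v|^2] equal to [q = (|g v| / |v|)^2], and leaves [q <= e^2]. *)
Lemma norm_le_of_quadratic (C : numClosedFieldType) (V : normedModType C)
    (g : V -> C) (e : C) :
  0 <= e -> (forall a v, g (a *: v) = a * g v) ->
  (forall v, g v + (g v)^* <= e ^+ 2 + `|v| ^+ 2) ->
  forall v, `|g v| <= e * `|v|.
Proof.
move=> e0 gZ gq v.
have [->|v0] := eqVneq v 0.
  by rewrite -[X in g X](scale0r (0 : V)) gZ mul0r !normr0 mulr0.
have nv0 : 0 < `|v| by rewrite normr_gt0.
rewrite -ler_pdivrMr // -(ler_pXn2r (n := 2)) ?nnegrE ?divr_ge0 ?(ltW nv0)//.
have := gq (((g v)^* / `|v| ^+ 2) *: v).
have nC : (`|v| ^+ 2)^* = `|v| ^+ 2 by rewrite geC0_conj ?exprn_ge0.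
set q := (`|g v| / `|v|) ^+ 2.
have qE : (g v)^* / `|v| ^+ 2 * g v = q.
  by rewrite mulrAC -normCKC /q expr_div_n.
have qr : q^* = q by rewrite /q geC0_conj// exprn_ge0// divr_ge0.
rewrite gZ qE qr normrZ exprMn normf_div norm_conjC normrX normr_id.
rewrite expr_div_n -mulrA -exprM.
have -> : `|g v| ^+ 2 * ((`|v| ^+ (2 * 2)) ^-1 * `|v| ^+ 2) = q.
  rewrite /q; field. by rewrite gt_eqF.
by rewrite lerD2r.
Qed.

Lemma innerC (R : realType) (H : hilbertType R) (x y : H) :
  (inner x y)^* = inner y x.
Proof. by rewrite [RHS]hermC expr0 mul1r. Qed.

(** Cauchy-Schwarz, from the expansion of [0 <= |y - v|^2]. *)
Lemma norm_inner_le (R : realType) (H : hilbertType R) (x y : H) :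
  `|inner x y| <= `|x| * `|y|.
Proof.
rewrite mulrC; apply: (@norm_le_of_quadratic _ H (inner^~ y)) => //.
  by move=> a v; rewrite linearZl_LR.
move=> v; rewrite -subr_ge0.
have := dnorm_ge0 (inner : {dot H for _}) (y - v).
by rewrite dnormB !inner_norm !innerC [inner v y + _]addrC.
Qed.

Lemma sqr_normD (R : realType) (H : hilbertType R) (x y : H) :
  `|x + y| ^+ 2 = `|x| ^+ 2 + `|y| ^+ 2 + (inner x y + inner y x).
Proof. by rewrite -!inner_norm dnormD innerC. Qed.

Lemma addC_conj_le (C : numClosedFieldType) (z : C) : z + z^* <= `|z| *+ 2.
Proof.
have zr : z + z^* \is Num.real by apply/CrealP; rewrite rmorphD/= conjCK addrC.
rewrite (le_trans (real_ler_norm zr))// (le_trans (ler_normD _ _))//.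
by rewrite norm_conjC.
Qed.

(** With [J v = |v|^2 - 2 Re (f v)], bounded below by [- M^2], take [x] with
    [J x] within [e^2] of the infimum.  Comparing [J x] with [J (x + v)] bounds
    twice the real part of [f v - <v,x>] by [e^2 + |v|^2] for every [v]. *)
Lemma approx_riesz (R : realType) (H : hilbertType R) (f : {scalar H}) (M : R) :
  (forall v, `|f v| <= M%:C%C * `|v|) ->
  forall e : R[i], 0 < e ->
  exists x : H, forall v, `|f v - inner v x| <= e * `|v|.
Proof.
move=> fM e e0.
pose J (v : H) : R[i] := `|v| ^+ 2 - (f v + (f v)^*).
have JR v : (complex.Re (J v))%:C%C = J v.
  apply: RRe_real; rewrite realB ?realX ?normr_real//.
  by apply/CrealP; rewrite rmorphD/= conjCK addrC.
have Jge v : - (M ^+ 2) <= complex.Re (J v).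
  rewrite -lecR JR rmorphN rmorphXn/=.
  have sq : 0 <= (`|v| - M%:C%C) ^+ 2.
    by rewrite real_exprn_even_ge0// realB ?normr_real ?complex_real//=.
  rewrite -subr_ge0; apply: (le_trans sq).
  have := le_trans (addC_conj_le _ (f v)) (ler_wMn2r 2 (fM v)).
  rewrite -subr_ge0 => h; rewrite -subr_ge0; apply: (le_trans h).
  by rewrite /J le_eqVlt; apply/orP; left; apply/eqP; ring.
pose E := [set complex.Re (J v) | v in [set: H]]%classic.
have lbE : has_lbound E by exists (- (M ^+ 2)) => _ [v _ <-].
have iE : has_inf E by split => //; exists (complex.Re (J 0)), 0.
have er : (complex.Re e)%:C%C = e by rewrite RRe_real// gtr0_real.
have e'0 : 0 < complex.Re e by rewrite -ltcR er.
have [_ [x _ <-] xE] := inf_adherent (exprn_gt0 2 e'0) iE.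
exists x; apply: (@norm_le_of_quadratic _ H (fun v => f v - inner v x)).
- exact: ltW.
- by move=> a v; rewrite linearZ linearZl_LR mulrBr.
move=> v.
have : J x <= J (x + v) + e ^+ 2.
  rewrite -(JR x) -(JR (x + v)) -[e]er -rmorphXn -rmorphD lecR.
  by rewrite (le_trans (ltW xE))// lerD2r ge_inf//; exists (x + v).
rewrite /J sqr_normD -subr_ge0 => h.
rewrite -subr_ge0; apply: (le_trans h).
rewrite linearD !rmorphD rmorphN/= innerC.
by rewrite le_eqVlt; apply/orP; left; apply/eqP; rewrite /=; ring.
Qed.

(** The sets [E e] of [e]-near representers of [f] are nonempty and have
    diameter at most [2 e], so they generate a Cauchy filter, whose limit
    represents [f]. *)
Lemma riesz (R : realType) (H : hilbertType R) (f : {scalar H}) (M : R) :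
  (forall v, `|f v| <= M%:C%C * `|v|) ->
  exists z : H, forall v, f v = inner v z.
Proof.
move=> fM.
pose E (e : R[i]) : set H :=
  [set x | forall v, `|f v - inner v x| <= e * `|v|]%classic.
pose F := filter_from [set e : R[i] | 0 < e]%classic E.
have FF : ProperFilter F.
  apply: filter_from_proper => [|e e0]; last exact: approx_riesz fM e e0.
  apply: filter_from_filter => [|i j i0 j0]; first by exists 1 => /=.
  have ij : i >=< j by rewrite real_comparable// gtr0_real.
  exists (Order.min i j) => [/=|x Ex]; first by rewrite comparable_lt_min ?i0.
  by split=> v; apply: (le_trans (Ex v)); rewrite ler_wpM2r//
    comparable_ge_min// lexx ?orbT.
have dist e x y : 0 < e -> E e x -> E e y -> `|x - y| <= e *+ 2.
  move=> e0 Ex Ey; have [->|xy] := eqVneq (x - y) 0.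
    by rewrite normr0 mulrn_wge0// ltW.
  rewrite -(ler_pM2r (x := `|x - y|)) ?normr_gt0// -expr2 -inner_norm.
  rewrite -(ger0_norm (dnorm_ge0 (inner : {dot H for _}) _)).
  have -> : inner (x - y) (x - y) =
      (f (x - y) - inner (x - y) y) - (f (x - y) - inner (x - y) x).
    by rewrite [LHS]linearBr; ring.
  rewrite (le_trans (ler_normB _ _))// mulrnAl mulr2n.
  by apply: lerD; [exact: Ey | exact: Ex].
have /cauchy_cvgP Fc : cauchy F.
  apply/cauchyP => e e0.
  have e20 : 0 < e / 2 / 2 by rewrite !divr_gt0.
  have /filter_ex[x Ex] : F (E (e / 2 / 2)) by exists (e / 2 / 2).
  exists x; exists (e / 2 / 2) => // y Ey.
  rewrite -ball_normE/=; apply: (le_lt_trans (dist _ _ _ e20 Ex Ey)).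
  rewrite -[X in X < _]mulr_natr divfK ?pnatr_eq0// ltr_pdivrMr// ltr_pMr//.
  by rewrite ltr1n.
exists (lim F) => v; apply/eqP; rewrite -subr_eq0 -normr_le0.
apply/ler_addgt0Pl => e e0; rewrite addr0.
(* [x] in [E d] and within [d] of the limit costs [d |v|] twice; the [1 +]
   only keeps the denominator nonzero when [v = 0]. *)
pose d := e / (1 + `|v|) / 2.
have d0 : 0 < d by rewrite !divr_gt0// ltr_wpDr.
have /filter_ex[x [Ex Dx]] : F (E d `&` [set x | `|lim F - x| < d])%classic.
  apply: filterI; first by exists d.
  by move: Fc => /fcvgrPdist_lt; apply.
rewrite -(subrKA (inner v x)) -linearBr (le_trans (ler_normD _ _))//.
apply: (@le_trans _ _ (d * `|v| + `|v| * d)).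
  apply: lerD; first exact: Ex.
  by rewrite (le_trans (norm_inner_le _ _ _ _))// ler_wpM2l// distrC ltW.
have -> : e = d * (1 + `|v|) *+ 2.
  by rewrite /d mulrAC -mulr_natr divfK ?pnatr_eq0// divfK// gt_eqF// ltr_wpDr.
by rewrite [`|v| * d]mulrC -mulr2n lerMn2r ler_wpM2l ?(ltW d0)//= lerDr ler01.
Qed.

Lemma le_numradius (R : realType) (H : hilbertType R) (T : H -> H) (M : R) :
  (forall x, `|x| = 1 -> `|inner (T x) x| <= M%:C%C) ->
  forall x, `|x| = 1 -> complex.Re `|inner (T x) x| <= numradius T.
Proof.
move=> TM x x1; apply: ub_le_sup; last by exists x.
by exists M => _ [y /TM yM <-]; rewrite -lecR RRe_real ?normr_real.
Qed.

Lemma le_opnorm (R : realType) (H : hilbertType R) (T : H -> H) :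
  bounded_op T -> forall x, `|x| = 1 -> complex.Re `|T x| <= opnorm T.
Proof.
move=> [M TM] x x1; apply: ub_le_sup; last by exists x.
exists M => _ [y /= y1 <-]; rewrite -lecR RRe_real ?normr_real//.
by rewrite -[leRHS]mulr1 -y1.
Qed.

(** This turns the choice operator in [adjoint] into a usable equation: Riesz
    applied to the functional [<T -, y>] shows that there is a [z] to choose. *)
Lemma inner_adjoint (R : realType) (H : hilbertType R) (T : {linear H -> H}) :
  bounded_op T -> forall x y, inner (T x) y = inner x (adjoint T y).
Proof.
move=> [M TM] x y; move: x.
apply: (@getPex H [set z | forall x, inner (T x) y = inner x z]%classic).
apply: (@riesz R H (applyr inner y \o T) (M * complex.Re `|y|)) => v /=.
rewrite (le_trans (norm_inner_le _ _ _ _))//.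
by rewrite rmorphM/= RRe_real ?normr_real// mulrAC ler_wpM2r.
Qed.

(** Weighting [u] and [v] by the conjugates of their own coefficients along [x]
    aligns the phases, so that the weighted sum [w] has inner product
    [|<u,x>|^2 + |<v,x>|^2] with [x]. *)
Lemma sqr_inner_pair_le (R : realType) (H : hilbertType R) (x u v : H) :
  `|x| = 1 ->
  (`|inner u x| ^+ 2 + `|inner v x| ^+ 2) ^+ 2 <=
    `|inner u x| ^+ 2 * `|u| ^+ 2 + `|inner v x| ^+ 2 * `|v| ^+ 2
    + `|inner u x| * `|inner v x| * `|inner u v| *+ 2.
Proof.
move=> x1; set a := inner u x; set b := inner v x.
pose w := a^* *: u + b^* *: v.
have wx : inner w x = `|a| ^+ 2 + `|b| ^+ 2.
  by rewrite linearDl !linearZl_LR/= !normCKC.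
have : `|inner w x| ^+ 2 <= `|w| ^+ 2.
  by rewrite lerXn2r ?nnegrE// (le_trans (norm_inner_le _ _ _ _))// x1 mulr1.
rewrite wx ger0_norm ?addr_ge0 ?exprn_ge0// => /le_trans; apply.
rewrite sqr_normD !normrZ !norm_conjC !exprMn lerD2l.
rewrite -[X in _ + X]innerC (le_trans (addC_conj_le _ _))// lerMn2r/=.
by rewrite linearZl_LR linearZr_LR/= conjCK !normrM norm_conjC mulrA.
Qed.

Theorem theorem2p1 (R : realType) (H : hilbertType R) (A B : {linear H -> H})
    (bA : bounded_op A) (bB : bounded_op B) :
  euclid_radius A B ^+ 2 <=
    Num.sqrt (numradius A ^+ 2 * opnorm A ^+ 2 + numradius B ^+ 2 * opnorm B ^+ 2
              + 2 * numradius A * numradius B * numradius (adjoint B \o A)).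
Proof.
set S := (X in Num.sqrt X).
have adjE (x : H) : `|inner ((adjoint B \o A) x) x| = `|inner (A x) (B x)|.
  by rewrite /= -innerC norm_conjC -inner_adjoint// -innerC norm_conjC.
have rad (T : H -> H) : bounded_op T ->
    forall x, `|x| = 1 -> complex.Re `|inner (T x) x| <= numradius T.
  move=> [M TM]; apply: (@le_numradius _ _ _ M) => x x1.
  rewrite (le_trans (norm_inner_le _ _ _ _))// x1 mulr1.
  by rewrite (le_trans (TM x))// x1 mulr1.
have radBA (x : H) : `|x| = 1 ->
    complex.Re `|inner (A x) (B x)| <= numradius (adjoint B \o A).
  case: (bA) (bB) => [M AM] [N BN] x1; rewrite -adjE; move: x x1.
  apply: (@le_numradius _ _ _ (M * N)) => x x1.
  rewrite adjE (le_trans (norm_inner_le _ _ _ _))// rmorphM/= ler_pM//.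
    by rewrite (le_trans (AM x))// x1 mulr1.
  by rewrite (le_trans (BN x))// x1 mulr1.
have key (x : H) : `|x| = 1 -> Num.sqrt (complex.Re `|inner (A x) x| ^+ 2
    + complex.Re `|inner (B x) x| ^+ 2) <= Num.sqrt (Num.sqrt S).
  move=> x1.
  have Rege0 (z : R[i]) : 0 <= complex.Re `|z|.
    by rewrite -ler0c RRe_real ?normr_real.
  have Rege0H (z : H) : 0 <= complex.Re `|z|.
    by rewrite -ler0c RRe_real ?normr_real.
  set a := complex.Re _; set b := complex.Re _.
  have [a0 b0] : 0 <= a /\ 0 <= b by split; exact: Rege0.
  have sqS : (a ^+ 2 + b ^+ 2) ^+ 2 <= S.
    apply: (@le_trans _ _ (a ^+ 2 * complex.Re `|A x| ^+ 2
      + b ^+ 2 * complex.Re `|B x| ^+ 2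
      + a * b * complex.Re `|inner (A x) (B x)| *+ 2)).
      rewrite -lecR !(rmorphD, rmorphXn, rmorphM, rmorphMn)/=.
      rewrite !RRe_real ?normr_real//.
      exact: sqr_inner_pair_le.
    have an := rad _ bA _ x1; have bn := rad _ bB _ x1.
    have An := le_opnorm _ _ _ bA _ x1; have Bn := le_opnorm _ _ _ bB _ x1.
    have le_sqr (r t : R) : 0 <= r -> r <= t -> r ^+ 2 <= t ^+ 2.
      by move=> r0 rt; rewrite lerXn2r ?nnegrE// (le_trans r0).
    apply: lerD.
      by apply: lerD; apply: ler_pM; rewrite ?exprn_ge0 ?Rege0H//;
        apply: le_sqr; rewrite ?Rege0H.
    rewrite -!mulrA [2 * _]mulr_natl lerMn2r/=.
    apply: ler_pM; rewrite ?mulr_ge0 ?Rege0//.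
    by apply: ler_pM; rewrite ?Rege0//; exact: radBA.
  rewrite ler_wsqrtr// -[leLHS]ger0_norm ?addr_ge0 ?sqr_ge0//.
  by rewrite -sqrtr_sqr ler_wsqrtr.
rewrite -[leRHS]sqr_sqrtr ?sqrtr_ge0//.
rewrite /euclid_radius; set D := (X in sup X).
(* The unit sphere is empty when [H] is trivial, and then the supremum is 0. *)
have [->|/set0P D0] := eqVneq D set0.
  by rewrite sup0 expr0n/= exprn_ge0// sqrtr_ge0.
rewrite lerXn2r ?nnegrE ?sqrtr_ge0//.
  have [d Dd] := D0; apply: (le_trans _ (ub_le_sup _ Dd)).
    by case: Dd => x _ <-; rewrite sqrtr_ge0.
  by exists (Num.sqrt (Num.sqrt S)) => _ [x x1 <-]; exact: key.
by apply: ge_sup => // _ [x x1 <-]; exact: key.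
Qed.
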